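(* Let $f\colon \mathbb{R}^d_{\ge}\to\mathbb{R}_{\ge}$ be a size function for ellipsoids such that $f\circ w^{1}$ is strictly concave on $\mathbb{R}^d_{\ge}$. Let $F\subset\mathbb{R}^d$ be a compact convex body. Then among all ellipsoids that are contained in $F$ there exists a unique ellipsoid that is maximal with respect to $f$; that is, there is exactly one ellipsoid $E\subset F$ such that $f(E')\le f(E)$ for every ellipsoid $E'\subset F$.
   Context: $\mathbb{R}_{\ge}$ denotes the non-negative reals and $\mathbb{R}^d_{\ge}$ the vectors in $\mathbb{R}^d$ with all entries in $\mathbb{R}_{\ge}$. A convex body is a compact convex set with non-empty interior. An ellipsoid in $\mathbb{R}^d$ is a set of the form $E=\{P\cdot x+t : x\in\mathbb{R}^d,\ \|x\|\le 1\}$ with $P\in\mathbb{R}^{d\times d}$ and $t\in\mathbb{R}^d$, where $\|\cdot\|$ is the Euclidean norm. Degenerate ellipsoids (with $P$ singular, hence with empty interior) are admitted. By the polar decomposition one may always choose $P$ symmetric and positive semi-definite; the semi-axis lengths of $E$ are then the eigenvalues of $P$. A function $f\colon\mathbb{R}^d_{\ge}\to\mathbb{R}_{\ge}$ is called a size function for ellipsoids if it is continuous, strictly monotone increasing in each of its arguments, and symmetric (i.e. $f(y)=f(x)$ whenever $y$ is a permutation of $x$). For an ellipsoid $E$, $f(E)$ denotes the value of $f$ at the vector of semi-axis lengths of $E$. For $p\in\mathbb{R}$, $w^p$ is the map $(x_1,\dots,x_d)^T\mapsto(|x_1|^p,\dots,|x_d|^p)^T$. In particular $w^1$ restricts to the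 identity on $\mathbb{R}^d_{\ge}$. *)

(* Defs.v *)
From HB Require Import structures.
From mathcomp Require Import all_boot all_order all_fingroup all_algebra.
From mathcomp Require Import all_classical all_reals all_analysis.

Set Implicit Arguments.
Unset Strict Implicit.
Unset Printing Implicit Defensive.

Import Order.TTheory GRing.Theory Num.Theory.
Import numFieldNormedType.Exports.

Local Open Scope classical_set_scope.
Local Open Scope ring_scope.

Section Ellipsoids.
Context {R : realType} {d : nat}.
Implicit Types (x y a t : 'cV[R]_d) (P : 'M[R]_d) (E F : set 'cV[R]_d).

(* The library norm `|x| on matrices is the sup norm, whence this one. *)
Definition euclidean_norm x : R := Num.sqrt (\sum_(i < d) x i ord0 ^+ 2).

Definition ellipsoid P t : set 'cV[R]_d :=
  [set P *m x + t | x in [set x | euclidean_norm x <= 1]].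

(* P is arbitrary, so degenerate ellipsoids (P singular) are included. *)
Definition is_ellipsoid E := exists P t, E = ellipsoid P t.

Definition sym_psd P :=
  P^T = P /\ forall x, 0 <= (x^T *m P *m x) ord0 ord0.

(* The entries of [a] are the eigenvalues of P, listed with multiplicity. *)
Definition eigenvalue_vector P a :=
  char_poly P = \prod_(i < d) ('X - (a i ord0)%:P).

Definition is_semi_axes E a :=
  exists P t, [/\ sym_psd P, E = ellipsoid P t & eigenvalue_vector P a].

(* Every ellipsoid has a vector of semi-axis lengths (polar decomposition and
   spectral theorem), and it is unique up to a permutation of the entries.
   One ordering is chosen here; a symmetric f does not depend on the choice. *)
Definition semi_axes E : 'cV[R]_d := xget 0 [set a | is_semi_axes E a].

Definition nonneg_orthant : set 'cV[R]_d := [set x | forall i, 0 <= x i ord0].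

(* Functions on the orthant are represented by total functions on R^d, whose
   values outside the orthant are irrelevant. *)
Definition strictly_increasing_in_each_argument (f : 'cV[R]_d -> R) :=
  forall x y (i : 'I_d), nonneg_orthant x -> nonneg_orthant y ->
    (forall j, j != i -> x j ord0 = y j ord0) -> x i ord0 < y i ord0 ->
    f x < f y.

Definition symmetric_function (f : 'cV[R]_d -> R) :=
  forall x (s : 'S_d), nonneg_orthant x -> f (row_perm s x) = f x.

Definition size_function (f : 'cV[R]_d -> R) :=
  [/\ forall x, nonneg_orthant x -> 0 <= f x,
      {within nonneg_orthant, continuous f},
      strictly_increasing_in_each_argument f
    & symmetric_function f].

Definition ellipsoid_size (f : 'cV[R]_d -> R) E : R := f (semi_axes E).

Definition w (p : R) x : 'cV[R]_d := \col_i powR `|x i ord0| p.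

Definition strictly_concave_on (A : set 'cV[R]_d) (g : 'cV[R]_d -> R) :=
  forall x y (l : R), A x -> A y -> x != y -> 0 < l < 1 ->
    l * g x + (1 - l) * g y < g (l *: x + (1 - l) *: y).

Definition convex_body F := [/\ compact F, convex_set F & F° !=set0].

Definition maximal_ellipsoid_in (f : 'cV[R]_d -> R) F E :=
  [/\ is_ellipsoid E, E `<=` F
    & forall E', is_ellipsoid E' -> E' `<=` F ->
        ellipsoid_size f E' <= ellipsoid_size f E].

End Ellipsoids.

(* Main.v *)
Require Import Defs.
From HB Require Import structures.
From mathcomp Require Import all_boot all_order all_fingroup all_algebra.
From mathcomp Require Import all_classical all_reals all_analysis.
From mathcomp Require Import ring lra.

(** An ellipsoid has a unique symmetric positive semidefinite matrix [P] and a
    unique centre [t], and its size is [f] of the eigenvalues of [P].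

    The central fact is an inequality for symmetric, strictly concave [f]: for
    every orthonormal frame [U], the size of [P] is at most [f] of the diagonal
    of [U^T P U], with equality only when [U] diagonalizes [P]
    ([eigenvalues_minimize]).  A frame minimizing [f] of the diagonal exists by
    compactness.  If an off-diagonal entry were nonzero there, one Jacobi
    rotation would write the diagonal as a nontrivial convex combination of the
    rotated diagonal and its transposition, so strict concavity would give a
    smaller value ([jacobi_decrease]).  Hence the minimizer is an eigenframe.
    Applied to minus the squared norm this argument also proves the spectral
    theorem.

    Existence: the triples of an orthonormal frame, nonnegative semi-axes and a
    centre that span an ellipsoid inside [F] form a compact set, on which [f] of
    the semi-axes is continuous ([exists_maximal_ellipsoid]).

    Uniqueness: let [(P, t)] and [(Q, s)] be maximal of size [m], and let [U]
    diagonalize [(P + Q) / 2].  The midpoint ellipsoid lies in [F], and its size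
    is [f] of the average of the diagonals [p], [q] of [U^T P U], [U^T Q U].
    Since [f p] and [f q] are at least [m], strict concavity forces [p = q];
    then the equality case forces [U] to diagonalize both [P] and [Q], so
    [P = Q] ([maximal_shape_unique]).  If the centres differed, the convex hull
    of the two translates would contain the ellipsoid of [P + c v v^T], with [v]
    half the translation; the same inequality and monotonicity of [f] make it
    strictly larger ([maximal_center_unique]). *)

Set Implicit Arguments.
Unset Strict Implicit.
Unset Printing Implicit Defensive.

Import Order.TTheory GRing.Theory Num.Theory.
Import numFieldNormedType.Exports.

Local Open Scope classical_set_scope.
Local Open Scope ring_scope.

(** * Compact sets of matrices *)

Lemma sum_continuous (R : realType) (T : topologicalType) (I : Type)
    (r : seq I) (g : I -> T -> R) :
  (forall i, continuous (g i)) -> continuous (fun x => \sum_(i <- r) g i x).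
Proof.
move=> gc; elim: r => [|i r IH].
  under eq_fun do rewrite big_nil.
  by move=> x; exact: cst_continuous.
under eq_fun do rewrite big_cons.
by move=> x; apply: cvgD; [exact: gc|exact: IH].
Qed.

Lemma mx_continuous (R : realType) (T : topologicalType) m n
    (g : T -> 'M[R]_(m, n)) :
  (forall i j, continuous (fun x => g x i j)) -> continuous g.
Proof.
move=> gc x A [P Pg PA].
suff : \forall y \near x, forall i j, P i j (g y i j).
  by apply: filterS => y; exact: PA.
by apply: filter_forall => i; apply: filter_forall => j; apply: gc; exact: Pg.
Qed.

Lemma entry_continuous (R : realType) (T : topologicalType) m n
    (g : T -> 'M[R]_(m, n)) i j :
  continuous g -> continuous (fun x => g x i j).
Proof.
move=> gc x; apply: (@continuous_comp _ _ _ g (fun M : 'M[R]_(m, n) => M i j)).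
  exact: gc.
exact: coord_continuous.
Qed.

Lemma mulmx_continuous (R : realType) (T : topologicalType) m n p
    (g : T -> 'M[R]_(m, n)) (h : T -> 'M[R]_(n, p)) :
  continuous g -> continuous h -> continuous (fun x => g x *m h x).
Proof.
move=> gc hc; apply: mx_continuous => i j.
under eq_fun do rewrite mxE.
apply: sum_continuous => k x.
by apply: cvgM; exact: entry_continuous.
Qed.

Lemma trmx_continuous (R : realType) (T : topologicalType) m n
    (g : T -> 'M[R]_(m, n)) :
  continuous g -> continuous (fun x => (g x)^T).
Proof.
move=> gc; apply: mx_continuous => i j.
by under eq_fun do rewrite mxE; exact: entry_continuous.
Qed.

Lemma diag_mx_continuous (R : realType) (T : topologicalType) n
    (g : T -> 'rV[R]_n) :
  continuous g -> continuous (fun x => diag_mx (g x)).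
Proof.
move=> gc; apply: mx_continuous => i j.
under eq_fun do rewrite mxE.
have [->|_] := eqVneq i j.
  by under eq_fun do rewrite mulr1n; exact: entry_continuous.
by under eq_fun do rewrite mulr0n; move=> x; exact: cst_continuous.
Qed.

Lemma mx_box_compact (R : realType) m n (C : R) :
  compact [set M : 'M[R]_(m, n) | forall i j, `|M i j| <= C].
Proof.
have -> : [set M : 'M[R]_(m, n) | forall i j, `|M i j| <= C] =
    vec_mx @` [set v : 'rV[R]_(m * n) | forall k, `[- C, C]%classic (v ord0 k)].
  apply/seteqP; split=> [M MC|_ [v vC <-] i j].
    exists (mxvec M); last exact: mxvecK.
    move=> k; case/mxvec_indexP: k => i j /=.
    by rewrite mxvecE in_itv/= -ler_norml.
  by rewrite mxE ler_norml; have := vC (mxvec_index i j); rewrite /= in_itv.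
apply: continuous_compact.
  apply: continuous_subspaceT; apply: mx_continuous => i j.
  under eq_fun do rewrite mxE.
  exact: coord_continuous.
apply: (@rV_compact _ _ (fun=> `[- C, C]%classic)) => _.
exact: segment_compact.
Qed.

Lemma closed_preimage (S T : topologicalType) (g : S -> T) (B : set T) :
  continuous g -> closed B -> closed (g @^-1` B).
Proof. by move=> /continuous_closedP; exact. Qed.

Definition orthogonal_mx (R : realType) n (U : 'M[R]_n) := U^T *m U = 1%:M.

Lemma orthogonal_entry_le1 (R : realType) n (U : 'M[R]_n) i j :
  orthogonal_mx U -> `|U i j| <= 1.
Proof.
move=> UU; rewrite -(@ler_pXn2r _ 2) ?nnegrE// expr1n real_normK ?num_real//.
have := congr1 (fun M : 'M[R]_n => M j j) UU; rewrite !mxE eqxx mulr1n => <-.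
rewrite (bigD1 i)//= mxE expr2 lerDl sumr_ge0// => k _.
by rewrite mxE -expr2 sqr_ge0.
Qed.

Lemma compact_orthogonal (R : realType) n :
  compact [set U : 'M[R]_n | orthogonal_mx U].
Proof.
apply: (subclosed_compact _ (@mx_box_compact R n n 1)).
  apply: (@closed_preimage _ _ (fun U : 'M[R]_n => U^T *m U) [set 1%:M]).
    apply: mulmx_continuous; last by move=> x; exact: cvg_id.
    by apply: (@trmx_continuous _ _ _ _ id) => x; exact: cvg_id.
  by apply: compact_closed; [exact: norm_hausdorff|exact: compact_set1].
by move=> U UU i j; exact: orthogonal_entry_le1.
Qed.

(** * The Euclidean inner product *)

Section InnerProduct.
Context {R : realType} {d : nat}.
Implicit Types (u v w : 'cV[R]_d) (M N : 'M[R]_d).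

Definition dot u v : R := (u^T *m v) ord0 ord0.

Lemma dotE u v : dot u v = \sum_i u i ord0 * v i ord0.
Proof. by rewrite /dot mxE; apply: eq_bigr => i _; rewrite mxE. Qed.

Lemma dotC u v : dot u v = dot v u.
Proof. by rewrite !dotE; apply: eq_bigr => i _; rewrite mulrC. Qed.

Lemma dotDl u v w : dot (u + v) w = dot u w + dot v w.
Proof. by rewrite /dot linearD mulmxDl mxE. Qed.

Lemma dotDr u v w : dot u (v + w) = dot u v + dot u w.
Proof. by rewrite /dot mulmxDr mxE. Qed.

Lemma dotZl a u v : dot (a *: u) v = a * dot u v.
Proof. by rewrite /dot linearZ -scalemxAl mxE. Qed.

Lemma dotZr a u v : dot u (a *: v) = a * dot u v.
Proof. by rewrite /dot -scalemxAr mxE. Qed.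

Lemma dotNr u v : dot u (- v) = - dot u v.
Proof. by rewrite /dot mulmxN mxE. Qed.

Lemma dotNl u v : dot (- u) v = - dot u v.
Proof. by rewrite dotC dotNr dotC. Qed.

Lemma dot0l u : dot 0 u = 0.
Proof. by rewrite /dot linear0 mul0mx mxE. Qed.

Lemma dot_trl M u v : dot (M *m u) v = dot u (M^T *m v).
Proof. by rewrite /dot trmx_mul mulmxA. Qed.

Lemma dot_trr M u v : dot u (M *m v) = dot (M^T *m u) v.
Proof. by rewrite dot_trl trmxK. Qed.

Lemma dot_ge0 u : 0 <= dot u u.
Proof. by rewrite dotE sumr_ge0// => i _; rewrite -expr2 sqr_ge0. Qed.

Lemma dot_eq0 u : dot u u = 0 -> u = 0.
Proof.
rewrite dotE => /eqP; rewrite psumr_eq0; last first.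
  by move=> i _; rewrite -expr2 sqr_ge0.
move=> /allP u0; apply/colP => i; rewrite mxE.
by have /(_ (mem_index_enum i)) := u0 i; rewrite -expr2 sqrf_eq0 => /eqP.
Qed.

Definition e_ (i : 'I_d) : 'cV[R]_d := delta_mx i ord0.

Lemma dot_e i v : dot (e_ i) v = v i ord0.
Proof.
rewrite dotE (bigD1 i)//= big1 ?addr0; first by rewrite mxE !eqxx mul1r.
by move=> j ji; rewrite mxE (negbTE ji) mul0r.
Qed.

Lemma dot_ee i j : dot (e_ i) (e_ j) = (i == j)%:R.
Proof. by rewrite dot_e mxE eqxx andbT. Qed.

Lemma dot_entry M i j : dot (e_ i) (M *m e_ j) = M i j.
Proof. by rewrite dot_e -colE mxE. Qed.

Lemma dot_conj_entry M N i j :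
  (N^T *m M *m N) i j = dot (col i N) (M *m col j N).
Proof. by rewrite -dot_entry -!mulmxA -dot_trl !colE. Qed.

Lemma sym_quad_eq0 M : M^T = M -> (forall u, dot u (M *m u) = 0) -> M = 0.
Proof.
move=> MT M0; apply/matrixP => i j; rewrite mxE.
have := M0 (e_ i + e_ j).
rewrite mulmxDr dotDl !dotDr !M0 add0r addr0 !dot_entry -[in M j i]MT mxE.
lra.
Qed.

Lemma euclidean_normE u : euclidean_norm u = Num.sqrt (dot u u).
Proof. by rewrite /euclidean_norm dotE; under eq_bigr do rewrite expr2. Qed.

Lemma euclidean_norm_le1 u : (euclidean_norm u <= 1) = (dot u u <= 1).
Proof.
by rewrite euclidean_normE -{1}(sqrtr1 R) ler_sqrt// ltr01.
Qed.

(** The form of the Cauchy-Schwarz inequality that bounds the support function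
    of the unit ball. *)
Lemma dot_le_norm u v : dot u u <= 1 -> dot u v <= euclidean_norm v.
Proof.
move=> u1; rewrite euclidean_normE; set n := Num.sqrt _.
have n2 : n ^+ 2 = dot v v by rewrite sqr_sqrtr ?dot_ge0.
have n0 : 0 <= n by exact: sqrtr_ge0.
have [nz|nz] := eqVneq n 0.
  have -> : v = 0 by apply: dot_eq0; rewrite -n2 nz expr0n.
  by rewrite dotC dot0l.
(* Expanding this square gives [2 n (u . v) <= 2 n^2]. *)
have := dot_ge0 (n *: u - v).
rewrite dotDl !dotDr !dotNl !dotNr !dotZl !dotZr (dotC v u) -n2.
have np : 0 < n by rewrite lt_neqAle eq_sym nz.
nra.
Qed.

Lemma sym_psdP M : sym_psd M <-> M^T = M /\ forall u, 0 <= dot u (M *m u).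
Proof.
rewrite /sym_psd /dot.
by split=> -[MT M0]; split=> // u; have := M0 u; rewrite mulmxA.
Qed.

End InnerProduct.

(** * Jacobi rotations *)

Section Jacobi.
Context {R : realType} {d : nat}.
Implicit Types (u v w : 'cV[R]_d) (P Q U V N : 'M[R]_d).

Definition diag_col P : 'cV[R]_d := \col_i P i i.

Lemma orthogonal_mxC U : orthogonal_mx U -> U *m U^T = 1%:M.
Proof. exact: mulmx1C. Qed.

Lemma orthogonal_mxM U V :
  orthogonal_mx U -> orthogonal_mx V -> orthogonal_mx (U *m V).
Proof.
rewrite /orthogonal_mx => UU VV.
by rewrite trmx_mul mulmxA -(mulmxA V^T) UU mulmx1.
Qed.

Lemma sym_psd_conj P N : sym_psd P -> sym_psd (N^T *m P *m N).
Proof.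
move=> /sym_psdP[PT P0]; apply/sym_psdP; split.
  by rewrite !trmx_mul trmxK PT mulmxA.
by move=> u; rewrite -!mulmxA -dot_trl.
Qed.

Lemma sym_psd_diag_ge0 P : sym_psd P -> nonneg_orthant (diag_col P).
Proof. by move=> /sym_psdP[_ P0] i; rewrite mxE -dot_entry. Qed.

(** The plane rotation that diagonalizes the symmetric matrix with diagonal
    [a], [b] and off-diagonal entry [c]: the last equation says that its new
    off-diagonal entry vanishes.  As [c] is nonzero, neither coordinate
    vanishes, which is what makes the convex combination in [jacobi_decrease]
    a strict one. *)
Lemma exists_rotation (a b c : R) : c != 0 ->
  exists x y : R, [/\ x ^+ 2 + y ^+ 2 = 1, x != 0, y != 0 &
    (x ^+ 2 - y ^+ 2) * c = x * y * (a - b)].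
Proof.
move=> c0.
have c2 : 0 < c ^+ 2 by rewrite exprn_even_gt0.
pose r := Num.sqrt ((a - b) ^+ 2 + 4 * c ^+ 2).
have r2 : r ^+ 2 = (a - b) ^+ 2 + 4 * c ^+ 2.
  by rewrite sqr_sqrtr// addr_ge0 ?sqr_ge0// mulr_ge0// ltW.
(* The eigenvalue is [a + mu], so that [(c, mu)] is an eigenvector. *)
pose mu := (b - a + r) / 2.
have muE : mu ^+ 2 + (a - b) * mu = c ^+ 2.
  have : 4 * (mu ^+ 2 + (a - b) * mu) = r ^+ 2 - (a - b) ^+ 2.
    by rewrite /mu; field.
  by rewrite r2; lra.
have mu0 : mu != 0.
  apply/eqP => mu0; move: muE; rewrite mu0 mulr0 expr0n addr0 => /eqP.
  by rewrite eq_sym gt_eqF.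
pose n := Num.sqrt (c ^+ 2 + mu ^+ 2).
have n2 : n ^+ 2 = c ^+ 2 + mu ^+ 2 by rewrite sqr_sqrtr// addr_ge0// ?sqr_ge0.
have n0 : n != 0.
  by rewrite -sqrf_eq0 n2 gt_eqF// ltr_pwDl// sqr_ge0.
exists (c / n), (mu / n); split.
- have -> : (c / n) ^+ 2 + (mu / n) ^+ 2 = (c ^+ 2 + mu ^+ 2) / n ^+ 2 by field.
  by rewrite -n2 divff// sqrf_eq0.
- by rewrite mulf_neq0// invr_eq0.
- by rewrite mulf_neq0// invr_eq0.
- have -> : ((c / n) ^+ 2 - (mu / n) ^+ 2) * c =
    (c ^+ 2 - mu ^+ 2) * c / n ^+ 2 by field.
  have -> : c / n * (mu / n) * (a - b) =
    c * mu * (a - b) / n ^+ 2 by field.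
  by congr (_ / _); rewrite -muE; ring.
Qed.

(** If a Jacobi rotation in the plane of [i] and [j] turns the diagonal [D] into
    [D'], with [S] the transposition of [D'], then [D = x^2 D' + (1 - x^2) S]
    because the rotated plane block is diagonal.  Here [D'] and [S] have the
    same value by symmetry and differ because [Q i j] is nonzero, so strict
    concavity makes [f D] larger. *)
Lemma jacobi_decrease (f : 'cV[R]_d -> R) Q i j :
  strictly_concave_on nonneg_orthant f -> symmetric_function f ->
  sym_psd Q -> i != j -> Q i j != 0 ->
  exists2 G, orthogonal_mx G &
    f (diag_col (G^T *m Q *m G)) < f (diag_col Q).
Proof.
move=> fconc fsym Qpsd ij Qij.
have QT : Q^T = Q by case: Qpsd.
have ji : j != i by rewrite eq_sym.
have [x [y [xy1 x0 y0 xyc]]] := exists_rotation (Q i i) (Q j j) Qij.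
(* A reflection serves as well as a rotation, and is symmetric in the plane. *)
pose g k : 'cV[R]_d := if k == i then x *: e_ i + y *: e_ j
  else if k == j then y *: e_ i - x *: e_ j else e_ k.
pose G := \matrix_(k, l) g l k ord0.
have colG k : col k G = g k by apply/colP => l; rewrite !mxE.
have gi : g i = x *: e_ i + y *: e_ j by rewrite /g eqxx.
have gj : g j = y *: e_ i - x *: e_ j by rewrite /g (negbTE ji) eqxx.
have gk k : k != i -> k != j -> g k = e_ k.
  by move=> /negbTE ki /negbTE kj; rewrite /g ki kj.
have Go : orthogonal_mx G.
  rewrite /orthogonal_mx -[G^T]mulmx1; apply/matrixP => k l.
  rewrite dot_conj_entry !colG mul1mx mxE.
  have xy1' : x * x + y * y = 1 by rewrite -xy1; ring.
  have [->|ki] := eqVneq k i; last have [->|kj] := eqVneq k j;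
    (have [->|li] := eqVneq l i; last have [->|lj] := eqVneq l j);
    rewrite ?gi ?gj ?gk// ?dotDl ?dotDr ?dotNl ?dotNr ?dotZl ?dotZr ?dot_ee
      ?eqxx ?(negbTE ij) ?(negbTE ji) ?(negbTE ki) ?(negbTE kj)
      1?[i == l]eq_sym 1?[j == l]eq_sym
      ?(negbTE li) ?(negbTE lj) /=; lra.
exists G => //.
set D' := diag_col (G^T *m Q *m G).
have D'0 : nonneg_orthant D' by exact/sym_psd_diag_ge0/sym_psd_conj.
have Qji : Q j i = Q i j by rewrite -[in LHS]QT mxE.
have D'i : D' i ord0 = x ^+ 2 * Q i i + 2 * x * y * Q i j + y ^+ 2 * Q j j.
  rewrite mxE dot_conj_entry colG gi mulmxDr -!scalemxAr.
  by rewrite !dotDl !dotDr !dotZl !dotZr !dot_entry Qji; ring.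
have D'j : D' j ord0 = y ^+ 2 * Q i i - 2 * x * y * Q i j + x ^+ 2 * Q j j.
  rewrite mxE dot_conj_entry colG gj mulmxDr mulmxN -!scalemxAr.
  by rewrite !dotDl !dotDr !dotNl !dotNr !dotZl !dotZr !dot_entry Qji; ring.
have D'k k : k != i -> k != j -> D' k ord0 = Q k k.
  by move=> ki kj; rewrite mxE dot_conj_entry colG gk// dot_entry.
pose S := row_perm (tperm i j) D'.
have SE k : S k ord0 = D' (tperm i j k) ord0 by rewrite mxE.
have S0 : nonneg_orthant S by move=> k; rewrite SE.
have yE : y ^+ 2 = 1 - x ^+ 2 by rewrite -xy1; ring.
(* [xy (D'_i - D'_j) = Q i j] by the choice of [x] and [y]. *)
have D'S : D' != S.
  apply/eqP => /colP/(_ i); rewrite SE tpermL => D'ij.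
  have : (x * y) * (D' i ord0 - D' j ord0) = 0 by rewrite D'ij subrr mulr0.
  rewrite D'i D'j.
  have -> : x * y * (x ^+ 2 * Q i i + 2 * x * y * Q i j + y ^+ 2 * Q j j -
      (y ^+ 2 * Q i i - 2 * x * y * Q i j + x ^+ 2 * Q j j)) =
    (x ^+ 2 - y ^+ 2) * (x * y * (Q i i - Q j j)) +
      4 * x ^+ 2 * y ^+ 2 * Q i j by ring.
  rewrite -xyc => /eqP.
  have -> : (x ^+ 2 - y ^+ 2) * ((x ^+ 2 - y ^+ 2) * Q i j) +
      4 * x ^+ 2 * y ^+ 2 * Q i j = (x ^+ 2 + y ^+ 2) ^+ 2 * Q i j by ring.
  by rewrite xy1 expr1n mul1r (negbTE Qij).
have x2 : 0 < x ^+ 2 < 1.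
  apply/andP; split; first by rewrite exprn_even_gt0.
  by rewrite -subr_gt0 -yE exprn_even_gt0.
have DE : diag_col Q = x ^+ 2 *: D' + (1 - x ^+ 2) *: S.
  apply/colP => k.
  rewrite [LHS]mxE [RHS]mxE [X in X + _]mxE [X in _ + X]mxE SE -yE.
  have [->|ki] := eqVneq k i; last have [->|kj] := eqVneq k j.
  - rewrite tpermL D'i D'j.
    have -> : x ^+ 2 * (x ^+ 2 * Q i i + 2 * x * y * Q i j + y ^+ 2 * Q j j) +
      y ^+ 2 * (y ^+ 2 * Q i i - 2 * x * y * Q i j + x ^+ 2 * Q j j) =
      (x ^+ 4 + y ^+ 4) * Q i i + 2 * x * y * ((x ^+ 2 - y ^+ 2) * Q i j)
      + 2 * x ^+ 2 * y ^+ 2 * Q j j by ring.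
    rewrite xyc; transitivity ((x ^+ 2 + y ^+ 2) ^+ 2 * Q i i); last by ring.
    by rewrite xy1 expr1n mul1r.
  - rewrite tpermR D'i D'j.
    have -> : x ^+ 2 * (y ^+ 2 * Q i i - 2 * x * y * Q i j + x ^+ 2 * Q j j) +
      y ^+ 2 * (x ^+ 2 * Q i i + 2 * x * y * Q i j + y ^+ 2 * Q j j) =
      (x ^+ 4 + y ^+ 4) * Q j j - 2 * x * y * ((x ^+ 2 - y ^+ 2) * Q i j)
      + 2 * x ^+ 2 * y ^+ 2 * Q i i by ring.
    rewrite xyc; transitivity ((x ^+ 2 + y ^+ 2) ^+ 2 * Q j j); last by ring.
    by rewrite xy1 expr1n mul1r.
  - by rewrite tpermD 1?eq_sym// D'k// -mulrDl xy1 mul1r.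
have := fconc _ _ _ D'0 S0 D'S x2.
by rewrite -DE fsym// -mulrDl addrC subrK mul1r.
Qed.
End Jacobi.

(** * Eigenvalues as a minimum over orthonormal frames *)

Section EigenvalueMinimum.
Context {R : realType} {d : nat}.
Implicit Types (P U V : 'M[R]_d) (a b : 'cV[R]_d).

Lemma char_poly_conj U P :
  orthogonal_mx U -> char_poly (U^T *m P *m U) = char_poly P.
Proof.
move=> UU; pose pU := map_mx (@polyC R) U; pose pUT := map_mx (@polyC R) U^T.
have pUU : pUT *m pU = 1%:M by rewrite -map_mxM UU map_mx1.
rewrite /char_poly.
have -> : char_poly_mx (U^T *m P *m U) = pUT *m char_poly_mx P *m pU.
  rewrite /char_poly_mx mulmxBr mulmxBl !map_mxM; congr (_ - _).
  by rewrite -mulmxA -scalar_mxC mulmxA pUU mul1mx.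
by rewrite !det_mulmx mulrAC -det_mulmx pUU det1 mul1r.
Qed.

Lemma diag_eigenvalue_vector U P : orthogonal_mx U ->
  is_diag_mx (U^T *m P *m U) -> eigenvalue_vector P (diag_col (U^T *m P *m U)).
Proof.
move=> UU UPU; rewrite /eigenvalue_vector -(char_poly_conj P UU).
rewrite char_poly_trig ?is_diag_mx_is_trig//.
by apply: eq_bigr => i _; rewrite [diag_col _ _ _]mxE.
Qed.

Lemma eigenvalue_vector_perm P a b :
  eigenvalue_vector P a -> eigenvalue_vector P b -> exists s, a = row_perm s b.
Proof.
rewrite /eigenvalue_vector => -> abE.
have : perm_eq [tuple a i ord0 | i < d] [tuple b i ord0 | i < d].
  by apply: prod_XsubC_eq; rewrite !big_map.
move=> /tuple_permP[s sE]; exists s; apply/colP => i; rewrite mxE.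
have /(congr1 (nth 0 ^~ i)) := sE.
by rewrite -!tnth_nth !tnth_mktuple.
Qed.

Context (f : 'cV[R]_d -> R).
Hypothesis fcont : {within nonneg_orthant, continuous f}.
Hypothesis fconc : strictly_concave_on nonneg_orthant f.
Hypothesis fsym : symmetric_function f.

Lemma exists_minimizing_frame P : sym_psd P ->
  exists2 V, orthogonal_mx V & forall U, orthogonal_mx U ->
    f (diag_col (V^T *m P *m V)) <= f (diag_col (U^T *m P *m U)).
Proof.
move=> Ppsd.
pose h U := diag_col (U^T *m P *m U).
have hc : continuous h.
  apply: mx_continuous => i j; under eq_fun do rewrite mxE.
  apply: entry_continuous.
  have idc : continuous (@id 'M[R]_d) by move=> U; exact: cvg_id.
  apply: mulmx_continuous => //; apply: mulmx_continuous.
    exact: (trmx_continuous idc).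
  by move=> U; exact: cst_continuous.
have hK : compact (h @` [set U | orthogonal_mx U]).
  apply: continuous_compact; first exact: continuous_subspaceT.
  exact: compact_orthogonal.
have h0 : h @` [set U | orthogonal_mx U] !=set0.
  by exists (h 1%:M), 1%:M => //=; rewrite /orthogonal_mx trmx1 mulmx1.
have [|_ /set_mem[V VV <-] Vmin] := @compact_EVT_min _ R f _ h0 hK.
  apply: continuous_subspaceW fcont => _ [U _ <-].
  exact/sym_psd_diag_ge0/sym_psd_conj.
by exists V => // U UU; apply: Vmin; apply/mem_set; exists U.
Qed.

(** At a minimizing frame no Jacobi rotation can decrease the value. *)
Lemma minimizing_frame_diag P V : sym_psd P -> orthogonal_mx V ->
  (forall U, orthogonal_mx U ->
    f (diag_col (V^T *m P *m V)) <= f (diag_col (U^T *m P *m U))) ->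
  is_diag_mx (V^T *m P *m V).
Proof.
move=> Ppsd VV Vmin; apply/is_diag_mxP => i j ij; apply/eqP.
apply: contraT => Qij.
have [G GG] := jacobi_decrease fconc fsym (sym_psd_conj V Ppsd) ij Qij.
rewrite ltNge; have := Vmin _ (orthogonal_mxM VV GG).
by rewrite trmx_mul !mulmxA => ->.
Qed.

(** For concave [f] this is the Schur-Horn inequality.  All minimizing frames
    are eigenframes; conversely all eigenframes have the same value, since their
    diagonals are permutations of one another, hence are all minimizing. *)
Lemma eigenvalues_minimize P a U : sym_psd P -> eigenvalue_vector P a ->
  orthogonal_mx U ->
  f a <= f (diag_col (U^T *m P *m U)) ?= iff is_diag_mx (U^T *m P *m U).
Proof.
move=> Ppsd Pa UU.
have [V VV Vmin] := exists_minimizing_frame Ppsd.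
have Vdiag := minimizing_frame_diag Ppsd VV Vmin.
have fE b : eigenvalue_vector P b -> f b = f (diag_col (V^T *m P *m V)).
  move=> Pb.
  have [s ->] := eigenvalue_vector_perm Pb (diag_eigenvalue_vector VV Vdiag).
  by rewrite fsym//; exact/sym_psd_diag_ge0/sym_psd_conj.
rewrite (fE a)//; split; first exact: Vmin.
apply/eqP/idP => [fVU|Udiag]; last first.
  by rewrite (fE _ (diag_eigenvalue_vector UU Udiag)).
by apply: (minimizing_frame_diag Ppsd UU) => W WW; rewrite -fVU; exact: Vmin.
Qed.

End EigenvalueMinimum.

(** * Spectral theorem, square roots and pseudo-inverses *)

Section SpectralTheorem.
Context {R : realType} {d : nat}.
Implicit Types (P Q U V M N : 'M[R]_d) (t s : 'cV[R]_d).

Lemma dot_perm (s : 'S_d) (x : 'cV[R]_d) :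
  dot (row_perm s x) (row_perm s x) = dot x x.
Proof.
rewrite !dotE [RHS](reindex_inj (@perm_inj _ s)).
by apply: eq_bigr => i _; rewrite mxE.
Qed.

(** With [f] minus the squared norm, minimizing [f] of the diagonal amounts to
    minimizing the off-diagonal part, since the Frobenius norm of [V^T P V] does
    not depend on [V]. *)
Lemma spectral_theorem P : sym_psd P ->
  exists2 V, orthogonal_mx V & is_diag_mx (V^T *m P *m V).
Proof.
move=> Ppsd; pose f (x : 'cV[R]_d) := - dot x x.
have fcont : {within nonneg_orthant, continuous f}.
  have idc : continuous (@id 'cV[R]_d) by move=> x; exact: cvg_id.
  have dotc : continuous (fun x : 'cV[R]_d => dot x x).
    apply: (entry_continuous (g := fun x : 'cV[R]_d => x^T *m x)).
    by apply: mulmx_continuous => //; exact: (trmx_continuous idc).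
  by apply: continuous_subspaceT => x; exact: (cvgN (dotc x)).
have fconc : strictly_concave_on nonneg_orthant f.
  move=> x y l _ _ xy /andP[l0 l1].
  have xy0 : 0 < dot (x - y) (x - y).
    rewrite lt_neqAle dot_ge0 andbT eq_sym; apply: contra_neq xy => xy0.
    by apply/eqP; rewrite -subr_eq0; apply/eqP/dot_eq0.
  rewrite /f -subr_gt0.
  have -> : - dot (l *: x + (1 - l) *: y) (l *: x + (1 - l) *: y) -
      (l * - dot x x + (1 - l) * - dot y y) =
      l * (1 - l) * dot (x - y) (x - y).
    by rewrite !dotDl !dotDr !dotNl !dotNr !dotZl !dotZr (dotC y x); ring.
  by rewrite !mulr_gt0// subr_gt0.
have fsym : symmetric_function f by move=> x s _; rewrite /f dot_perm.
have [V VV Vmin] := exists_minimizing_frame fcont Ppsd.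
by exists V => //; exact: (minimizing_frame_diag fconc fsym Ppsd VV Vmin).
Qed.

Lemma orthogonal_conjK V M N : orthogonal_mx V ->
  (V *m M *m V^T) *m (V *m N *m V^T) = V *m (M *m N) *m V^T.
Proof.
by move=> VV; rewrite !mulmxA -(mulmxA _ V^T V) VV mulmx1.
Qed.

Lemma sym_psd_eigendecomposition P : sym_psd P -> exists V (a : 'rV[R]_d),
  [/\ orthogonal_mx V, forall i, 0 <= a ord0 i & P = V *m diag_mx a *m V^T].
Proof.
move=> Ppsd; have [V VV /diag_mxP[a aE]] := spectral_theorem Ppsd.
exists V, a; split=> //.
  move=> i; have := sym_psd_diag_ge0 (sym_psd_conj V Ppsd) i.
  by rewrite aE !mxE eqxx mulr1n.
have VV' := orthogonal_mxC VV.
by rewrite -aE !mulmxA VV' mul1mx -mulmxA VV' mulmx1.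
Qed.

Lemma sym_psd_diag_conj V (a : 'rV[R]_d) : (forall i, 0 <= a ord0 i) ->
  sym_psd (V *m diag_mx a *m V^T).
Proof.
move=> a0; rewrite -{1}[V]trmxK; apply: sym_psd_conj; apply/sym_psdP.
split; first exact: tr_diag_mx.
move=> u; rewrite dotE sumr_ge0// => i _.
by rewrite mul_diag_mx mxE mulrCA mulr_ge0// -expr2 sqr_ge0.
Qed.

Lemma diag_conj_eigenvalue_vector V (a : 'rV[R]_d) : orthogonal_mx V ->
  eigenvalue_vector (V *m diag_mx a *m V^T) a^T.
Proof.
move=> VV.
have E : V^T *m (V *m diag_mx a *m V^T) *m V = diag_mx a.
  by rewrite !mulmxA VV mul1mx -mulmxA VV mulmx1.
have -> : a^T = diag_col (V^T *m (V *m diag_mx a *m V^T) *m V).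
  by rewrite E; apply/colP => i; rewrite !mxE eqxx mulr1n.
by apply: diag_eigenvalue_vector => //; rewrite E diag_mx_is_diag.
Qed.

Lemma eigenvalue_vector_ge0 P (a : 'cV[R]_d) :
  sym_psd P -> eigenvalue_vector P a -> nonneg_orthant a.
Proof.
move=> Ppsd Pa; have [V VV Vdiag] := spectral_theorem Ppsd.
have [s ->] := eigenvalue_vector_perm Pa (diag_eigenvalue_vector VV Vdiag).
by move=> i; rewrite mxE; exact: (sym_psd_diag_ge0 (sym_psd_conj V Ppsd)).
Qed.

Lemma exists_eigenvalue_vector P : sym_psd P -> exists a, eigenvalue_vector P a.
Proof.
move=> Ppsd; have [V VV Vdiag] := spectral_theorem Ppsd.
by exists (diag_col (V^T *m P *m V)); exact: diag_eigenvalue_vector.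
Qed.

Lemma sym_psd_gram M : sym_psd (M *m M^T).
Proof.
apply/sym_psdP; split; first by rewrite trmx_mul trmxK.
by move=> u; rewrite -mulmxA dot_trr dot_ge0.
Qed.

Lemma sym_psd_sqrt P : sym_psd P -> exists2 Q, sym_psd Q & Q *m Q = P.
Proof.
move=> /sym_psd_eigendecomposition[V [a [VV a0 ->]]].
pose b : 'rV[R]_d := \row_i Num.sqrt (a ord0 i).
exists (V *m diag_mx b *m V^T).
  by apply: sym_psd_diag_conj => i; rewrite mxE sqrtr_ge0.
rewrite orthogonal_conjK// mulmx_diag; congr (_ *m diag_mx _ *m _).
by apply/rowP => i; rewrite !mxE -expr2 sqr_sqrtr.
Qed.

(** The Moore-Penrose inverse, obtained by inverting the nonzero eigenvalues; it
    takes the place of the inverse for degenerate ellipsoids. *)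
Lemma sym_psd_pinv P : sym_psd P ->
  exists Q, [/\ Q^T = Q, P *m Q *m P = P & Q *m P *m Q = Q].
Proof.
move=> /sym_psd_eigendecomposition[V [a [VV a0 ->]]].
(* The convention [0^-1 = 0] leaves the zero eigenvalues in place. *)
pose b : 'rV[R]_d := \row_i (a ord0 i)^-1.
have abE (x : R) : x * x^-1 * x = x.
  by have [->|x0] := eqVneq x 0; [rewrite mulr0|rewrite divff// mul1r].
exists (V *m diag_mx b *m V^T); rewrite !orthogonal_conjK// !mulmx_diag.
split.
- by rewrite !trmx_mul trmxK tr_diag_mx mulmxA.
- by congr (_ *m diag_mx _ *m _); apply/rowP => i; rewrite !mxE.
- congr (_ *m diag_mx _ *m _); apply/rowP => i; rewrite !mxE.
  by rewrite -{2}[a ord0 i]invrK.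
Qed.

Lemma mulmx_col_eq0 M : (forall u : 'cV[R]_d, M *m u = 0) -> M = 0.
Proof.
by move=> M0; apply/matrixP => i j; rewrite -dot_entry M0 dotC dot0l mxE.
Qed.

Lemma gram_eq0 M : M *m M^T = 0 -> M = 0.
Proof.
move=> M0; apply: trmx_inj; rewrite trmx0; apply: mulmx_col_eq0 => u.
by apply: dot_eq0; rewrite dot_trl trmxK mulmxA M0 mul0mx dotC dot0l.
Qed.

(** With [D = P - Q], the equation [P^2 = Q^2] gives
    [D (P + Q) + (P + Q) D = 0], so [D (P + Q) D] has zero trace.  As it is
    positive semidefinite, [P] and [Q] both vanish on the image of [D], hence
    [D^2 = 0]. *)
Lemma sym_psd_sqr_inj P Q : sym_psd P -> sym_psd Q -> P *m P = Q *m Q -> P = Q.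
Proof.
move=> Ppsd Qpsd PQ.
have [[PT P0] [QT Q0]] := ((sym_psdP P).1 Ppsd, (sym_psdP Q).1 Qpsd).
have [D DE] : exists D, D = P - Q by exists (P - Q).
have DT : D^T = D by rewrite DE linearB /= PT QT.
have DPQ : D *m (P + Q) + (P + Q) *m D = 0.
  rewrite DE mulmxBl mulmxBr !mulmxDl !mulmxDr PQ.
  by rewrite !opprD !addrA; apply/matrixP => i j; rewrite !mxE; ring.
have trD : \tr (D *m (P + Q) *m D) = 0.
  have : \tr ((D *m (P + Q) + (P + Q) *m D) *m D) = 0.
    by rewrite DPQ mul0mx mxtrace0.
  by rewrite mulmxDl mxtraceD [X in _ + X]mxtrace_mulC mulmxA; lra.
have DPQ0 i : dot (D *m e_ i) ((P + Q) *m (D *m e_ i)) = 0.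
  move: trD; rewrite /mxtrace => /eqP; rewrite psumr_eq0.
    move=> /allP/(_ i (mem_index_enum i))/= /eqP.
    by rewrite -dot_entry -!mulmxA dot_trr DT.
  move=> {}i _; rewrite -dot_entry -!mulmxA dot_trr DT mulmxDl dotDr.
  by rewrite addr_ge0.
have quad0 M (v : 'cV[R]_d) : sym_psd M -> dot v (M *m v) = 0 -> M *m v = 0.
  move=> Mpsd; have [S Spsd <-] := sym_psd_sqrt Mpsd.
  have [ST _] := Spsd.
  by rewrite -mulmxA dot_trr ST => /dot_eq0 ->; rewrite mulmx0.
have DD0 i : D *m (D *m e_ i) = 0.
  have := DPQ0 i; rewrite mulmxDl dotDr => /eqP.
  rewrite paddr_eq0// => /andP[/eqP Pi /eqP Qi].
  by rewrite {1}DE mulmxBl (quad0 P)// (quad0 Q)// subrr.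
apply/eqP; rewrite -subr_eq0 -DE; apply/eqP.
apply: gram_eq0; rewrite DT; apply/matrixP => i j.
by rewrite -dot_entry -mulmxA DD0 dotC dot0l mxE.
Qed.

End SpectralTheorem.

(** * Matrices and semi-axes of an ellipsoid *)

Section EllipsoidRepresentation.
Context {R : realType} {d : nat}.
Implicit Types (A B P Q : 'M[R]_d) (t s u x : 'cV[R]_d).

Lemma mem_ellipsoid A t x : dot x x <= 1 -> ellipsoid A t (A *m x + t).
Proof. by move=> x1; exists x => //=; rewrite euclidean_norm_le1. Qed.

Lemma ellipsoid_sub A t (F : set 'cV[R]_d) :
  (forall x, dot x x <= 1 -> F (A *m x + t)) -> ellipsoid A t `<=` F.
Proof. by move=> AF _ [x /=+ <-]; rewrite euclidean_norm_le1; exact: AF. Qed.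

(** Two matrices with the same Gram matrix [M] differ by a partial isometry:
    [K = B^T M^+ A], where [M^+] is the pseudo-inverse.  It is contracting since
    [K^T K = A^T M^+ A] is an orthogonal projection. *)
Lemma gram_eq_contraction A B : A *m A^T = B *m B^T ->
  exists2 K, B *m K = A & forall x, dot (K *m x) (K *m x) <= dot x x.
Proof.
move=> AB.
have [N [NT MNM NMN]] := sym_psd_pinv (sym_psd_gram A).
have MNA : A *m A^T *m N *m A = A.
  apply/eqP; rewrite -subr_eq0; apply/eqP/gram_eq0.
  set X := A *m A^T *m N *m A.
  have -> : (X - A) *m (X - A)^T =
      A *m A^T *m N *m (A *m A^T) *m (N *m (A *m A^T)) -
      A *m A^T *m N *m (A *m A^T) - (A *m A^T *m (N *m (A *m A^T)) - A *m A^T).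
    by rewrite linearB /= !trmx_mul NT trmxK !mulmxBl !mulmxBr !mulmxA.
  by rewrite MNM subrr.
exists (B^T *m N *m A); first by rewrite !mulmxA -AB.
move=> x; set y := (B^T *m N *m A) *m x.
pose Z := A^T *m N *m A.
have ZT : Z^T = Z by rewrite /Z !trmx_mul trmxK NT mulmxA.
have ZZ : Z^T *m Z = Z.
  by rewrite ZT /Z -[in RHS]NMN !mulmxA.
have yE : dot y y = dot x (Z *m x).
  rewrite /y dot_trl mulmxA; congr (dot _ (_ *m _)).
  by rewrite !trmx_mul trmxK NT /Z -[in RHS]NMN AB !mulmxA.
have zE : dot (Z *m x) (Z *m x) = dot x (Z *m x) by rewrite dot_trl mulmxA ZZ.
have := dot_ge0 (x - Z *m x).
rewrite dotDl !dotDr !dotNl !dotNr zE (dotC _ x) yE; lra.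
Qed.

Lemma gram_eq_ellipsoid A B t :
  A *m A^T = B *m B^T -> ellipsoid A t = ellipsoid B t.
Proof.
have sub A' B' : A' *m A'^T = B' *m B'^T -> ellipsoid A' t `<=` ellipsoid B' t.
  move=> /gram_eq_contraction[K <- Kx]; apply: ellipsoid_sub => x x1.
  by rewrite -mulmxA; apply: mem_ellipsoid; exact: le_trans (Kx x) x1.
by move=> AB; apply/seteqP; split; exact: sub.
Qed.

(** The two sides are the support functions of the two ellipsoids in the
    direction [u]. *)
Lemma ellipsoid_support_le A B t s u : ellipsoid A t `<=` ellipsoid B s ->
  euclidean_norm (A^T *m u) + dot u t <= euclidean_norm (B^T *m u) + dot u s.
Proof.
move=> AB; set w := A^T *m u; set n := euclidean_norm w.
have n2 : n ^+ 2 = dot w w by rewrite /n euclidean_normE sqr_sqrtr ?dot_ge0.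
(* When [n = 0] this is the centre, where the support function is attained. *)
pose x := n^-1 *: w.
have x1 : dot x x <= 1.
  rewrite dotZl dotZr -n2 mulrA.
  have [->|n0] := eqVneq n 0; first by rewrite expr0n mulr0 ler01.
  by rewrite -expr2 -exprMn mulVf// expr1n.
have [y /=] := AB _ (mem_ellipsoid A t x1).
rewrite euclidean_norm_le1 => y1 yE.
have -> : n + dot u t = dot u (A *m x + t).
  rewrite dotDr dot_trr dotZr -/w -n2; congr (_ + _).
  have [->|n0] := eqVneq n 0; first by rewrite expr0n mulr0.
  by rewrite expr2 mulKf.
rewrite -yE dotDr lerD2r dot_trr dotC; exact: dot_le_norm.
Qed.

(** The support function [u |-> |A^T u| + u . t] has odd part [u . t], and the
    square of its even part is the quadratic form of [A A^T]. *)
Lemma ellipsoid_inj A B t s : ellipsoid A t = ellipsoid B s ->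
  A *m A^T = B *m B^T /\ t = s.
Proof.
move=> AB.
have supp u : euclidean_norm (A^T *m u) + dot u t =
              euclidean_norm (B^T *m u) + dot u s.
  by apply/eqP; rewrite eq_le !ellipsoid_support_le// AB.
have normN x : euclidean_norm (- x) = euclidean_norm x.
  by rewrite !euclidean_normE dotNl dotNr opprK.
have ts : t = s.
  apply/colP => i.
  have := supp (e_ i); have := supp (- e_ i).
  by rewrite !mulmxN !normN !dotNl !dot_e; lra.
split=> //; apply/eqP; rewrite -subr_eq0; apply/eqP/sym_quad_eq0.
  by rewrite linearB /= !trmx_mul !trmxK.
move=> u; apply/eqP.
rewrite mulmxBl dotDr dotNr -!mulmxA (dot_trr A) (dot_trr B).
have /eqP := supp u; rewrite ts (inj_eq (addIr _)) => /eqP.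
rewrite !euclidean_normE => /(congr1 (fun r => r ^+ 2)) /=.
by rewrite !sqr_sqrtr ?dot_ge0// => ->; rewrite subrr.
Qed.

(** The polar decomposition, in the form needed: [A] may be replaced by the
    square root of [A A^T]. *)
Lemma ellipsoid_sym_psd E : is_ellipsoid E ->
  exists P t, sym_psd P /\ E = ellipsoid P t.
Proof.
move=> [A [t ->]]; have [P Ppsd PA] := sym_psd_sqrt (sym_psd_gram A).
exists P, t; split=> //; apply: gram_eq_ellipsoid.
by case: (Ppsd) => -> _; rewrite PA.
Qed.

(** The choice made in [semi_axes] is harmless: the symmetric positive
    semidefinite matrix of an ellipsoid is unique, so two vectors of semi-axes
    are permutations of each other. *)
Lemma ellipsoid_size_eigenvalues (f : 'cV[R]_d -> R) P t a :
  symmetric_function f -> sym_psd P -> eigenvalue_vector P a ->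
  ellipsoid_size f (ellipsoid P t) = f a.
Proof.
move=> fsym Ppsd Pa; rewrite /ellipsoid_size.
have : is_semi_axes (ellipsoid P t) (semi_axes (ellipsoid P t)).
  by apply: (xgetPex (0 : 'cV[R]_d)); exists a, P, t.
move=> [Q [s [Qpsd /ellipsoid_inj[+ _] Qb]]].
case: (Ppsd) (Qpsd) => -> _ [-> _] /(sym_psd_sqr_inj Ppsd Qpsd) PQ.
rewrite -PQ in Qb.
have [p ->] := eigenvalue_vector_perm Qb Pa.
by rewrite fsym//; exact: eigenvalue_vector_ge0 Pa.
Qed.

End EllipsoidRepresentation.

(** * Convexity and monotonicity on the orthant *)

Section Convexity.
Context {R : realType} {d : nat}.
Implicit Types (P Q U : 'M[R]_d) (t s x y : 'cV[R]_d) (F : set 'cV[R]_d).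

Lemma convex_set_comb F x y (l : R) : convex_set F -> F x -> F y ->
  0 <= l <= 1 -> F (l *: x + (1 - l) *: y).
Proof.
move=> cF Fx Fy /andP[l0 l1].
by have := cF x y (Itv01 l0 l1) (mem_set Fx) (mem_set Fy); rewrite inE.
Qed.

Lemma nonneg_orthant_comb x y (l : R) : nonneg_orthant x -> nonneg_orthant y ->
  0 < l < 1 -> nonneg_orthant (l *: x + (1 - l) *: y).
Proof.
move=> x0 y0 /andP[l0 l1] i; rewrite !mxE.
by rewrite addr_ge0 ?mulr_ge0 ?subr_ge0// ltW.
Qed.

Lemma strictly_concave_w1 (f : 'cV[R]_d -> R) :
  strictly_concave_on nonneg_orthant (f \o w 1) ->
  strictly_concave_on nonneg_orthant f.
Proof.
have w1E x : nonneg_orthant x -> w 1 x = x.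
  by move=> x0; apply/colP => i; rewrite mxE powRr1// ger0_norm.
move=> fc x y l x0 y0 xy l01; have := fc x y l x0 y0 xy l01.
by rewrite /= !w1E//; exact: nonneg_orthant_comb.
Qed.

(** The coordinates in which [x] and [y] differ are raised one at a time. *)
Lemma increasing_le (f : 'cV[R]_d -> R) x y :
  strictly_increasing_in_each_argument f -> nonneg_orthant x ->
  (forall i, x i ord0 <= y i ord0) -> f x <= f y.
Proof.
move=> finc; have [n] := ubnP #|[pred i | x i ord0 != y i ord0]|.
elim: n x => // n IHn x card_xy x0 xy.
have y0 : nonneg_orthant y by move=> i; exact: le_trans (x0 i) (xy i).
have [->//|xNy] := eqVneq x y.
have [i xyi] : exists i, x i ord0 != y i ord0.
  apply/existsP; apply: contraNT xNy => /existsPn xy_eq.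
  by apply/eqP/colP => i; apply/eqP; have := xy_eq i; rewrite negbK.
pose z : 'cV[R]_d := \col_k if k == i then y k ord0 else x k ord0.
have zi : z i ord0 = y i ord0 by rewrite mxE eqxx.
have zk k : k != i -> z k ord0 = x k ord0 by move=> /negbTE ki; rewrite mxE ki.
have z0 : nonneg_orthant z by move=> k; rewrite mxE; case: ifP.
apply: (@le_trans _ _ (f z)).
  apply/ltW/(finc x z i) => //; first by move=> k ki; rewrite zk.
  by rewrite zi lt_neqAle xyi xy.
apply: IHn => //; last by move=> k; rewrite mxE; case: ifP.
rewrite -ltnS; apply: leq_ltn_trans card_xy; apply: proper_card.
apply/properP; split.
  apply/fintype.subsetP => k; rewrite !inE mxE; case: (k =P i) => // _.
  by rewrite eqxx.
by exists i; rewrite !inE ?zi ?eqxx.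
Qed.

Lemma increasing_lt (f : 'cV[R]_d -> R) x y i :
  strictly_increasing_in_each_argument f -> nonneg_orthant x ->
  (forall i, x i ord0 <= y i ord0) -> x i ord0 < y i ord0 -> f x < f y.
Proof.
move=> finc x0 xy xyi.
pose z : 'cV[R]_d := \col_k if k == i then y k ord0 else x k ord0.
have z0 : nonneg_orthant z.
  by move=> k; rewrite mxE; case: ifP => // _; exact: le_trans (x0 k) (xy k).
apply: (@lt_le_trans _ _ (f z)).
  apply: (finc x z i) => //; last by rewrite mxE eqxx.
  by move=> k /negbTE ki; rewrite mxE ki.
by apply: increasing_le => // k; rewrite mxE; case: ifP.
Qed.

End Convexity.

(** * Existence of a maximal ellipsoid *)

Section Existence.
Context {R : realType} {d : nat}.
Implicit Types (P U : 'M[R]_d) (a : 'rV[R]_d) (t x : 'cV[R]_d)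
  (F : set 'cV[R]_d).

Local Notation frame := ('M[R]_d * 'rV[R]_d * 'cV[R]_d)%type.

(** Orthonormal frame, semi-axes and centre.  As the semi-axes are an
    explicit coordinate, the size is [f] after a projection, so its continuity
    is that of [f]. *)
Definition inscribed_frames F : set frame :=
  [set z : frame | [/\ orthogonal_mx z.1.1, forall i, 0 <= z.1.2 ord0 i &
    forall x, dot x x <= 1 ->
      F (z.1.1 *m diag_mx z.1.2 *m z.1.1^T *m x + z.2)]].

Lemma inscribed_frames_compact F : compact F -> compact (inscribed_frames F).
Proof.
move=> Fcpt.
have [C FC] : exists C : R, forall x i, F x -> `|x i ord0| <= C.
  have [C [_ CF]] := compact_bounded Fcpt.
  exists (C + 1) => x i Fx; apply: le_trans (CF _ _ _ Fx);
    last by rewrite ltrDl.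
  rewrite [leRHS]/Num.Def.normr /= mx_normrE.
  exact: (le_bigmax _ (fun ij : 'I_d * 'I_1 => `|x ij.1 ij.2|) (i, ord0)).
have Kbox := compact_setX (compact_setX (@mx_box_compact R d d 1)
  (@mx_box_compact R 1 d ((C + C) *+ d))) (@mx_box_compact R d 1 C).
apply: (subclosed_compact _ Kbox); last first.
  move=> [[U a] t] [/= UU a0 UF].
  have tF : F t by have := UF 0; rewrite dot0l ler01 mulmx0 add0r; exact.
  split; [split|] => /= i j; first exact: orthogonal_entry_le1.
    (* The semi-axis [a_j] is [u_j . P u_j], where [u_j] is a unit vector and
       [P u_j] a difference of two points of [F]. *)
    rewrite ord1 ger0_norm//.
    have colj : dot (col j U) (col j U) = 1.
      by have := dot_conj_entry 1%:M U j j; rewrite mulmx1 mul1mx UU mxE eqxx.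
    have Fj := UF (col j U); rewrite colj lexx in Fj; have {}Fj := Fj isT.
    have -> : a ord0 j =
        dot (col j U) (U *m diag_mx a *m U^T *m col j U).
      rewrite -dot_conj_entry !mulmxA UU mul1mx -mulmxA UU mulmx1.
      by rewrite mxE eqxx mulr1n.
    set y := U *m _ *m _ *m _ in Fj *.
    have yC k : `|y k ord0| <= C + C.
      have -> : y k ord0 = (y + t) k ord0 - t k ord0.
        by rewrite [X in X - _]mxE addrK.
      by apply: le_trans (ler_normB _ _) _; rewrite lerD// FC.
    rewrite dotE; apply: le_trans (ler_norm _) _.
    apply: le_trans (ler_norm_sum _ _ _) _.
    rewrite -[leRHS]/((C + C) *+ d) -[X in _ *+ X]card_ord -sumr_const.
    apply: ler_sum => k _; rewrite normrM -[leRHS]mul1r ler_pM// mxE.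
    exact: orthogonal_entry_le1.
  by rewrite ord1; exact: FC.
have Uc : continuous (fun z : frame => z.1.1).
  move=> z; apply: (@continuous_comp _ _ _ fst fst); exact: cvg_fst.
have ac : continuous (fun z : frame => z.1.2).
  move=> z; apply: (@continuous_comp _ _ _ fst snd).
    exact: cvg_fst.
  exact: cvg_snd.
have tc : continuous (fun z : frame => z.2).
  move=> z; exact: cvg_snd.
have UTc := trmx_continuous Uc.
have -> : inscribed_frames F =
    (fun z : frame => z.1.1^T *m z.1.1) @^-1` [set 1%:M] `&`
    \bigcap_(i in [set: 'I_d])
      (fun z : frame => z.1.2 ord0 i) @^-1` [set r | 0 <= r] `&`
    \bigcap_(x in [set x | dot x x <= 1])
      (fun z : frame => z.1.1 *m diag_mx z.1.2 *m z.1.1^T *m x + z.2) @^-1` F.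
  apply/seteqP; split=> z.
    move=> [UU a0 UF].
    by split=> [|x x1]; [split=> [|i _]|]; [|exact: a0|exact: UF].
  by move=> [[UU a0] UF]; split=> // i; exact: a0.
apply: closedI; first apply: closedI.
- apply: closed_preimage; first exact: mulmx_continuous.
  by apply: compact_closed; [exact: norm_hausdorff|exact: compact_set1].
- apply: closed_bigI => i _; apply: closed_preimage; last exact: closed_ge.
  exact: entry_continuous.
- apply: closed_bigI => x _; apply: closed_preimage; last first.
    by apply: compact_closed => //; exact: norm_hausdorff.
  have Mxc : continuous (fun z : frame =>
      z.1.1 *m diag_mx z.1.2 *m z.1.1^T *m x).
    apply: mulmx_continuous; last by move=> ?; exact: cst_continuous.
    apply: mulmx_continuous => //; apply: mulmx_continuous => //.
    exact: diag_mx_continuous.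
  by move=> z; apply: cvgD; [exact: Mxc|exact: tc].
Qed.

Lemma exists_maximal_ellipsoid (f : 'cV[R]_d -> R) F :
  {within nonneg_orthant, continuous f} -> symmetric_function f ->
  compact F -> F !=set0 -> exists E, maximal_ellipsoid_in f F E.
Proof.
move=> fcont fsym Fcpt [p Fp].
pose axes (z : frame) : 'cV[R]_d := z.1.2^T.
have axesc : continuous axes.
  apply: trmx_continuous => z; apply: (@continuous_comp _ _ _ fst snd).
    exact: cvg_fst.
  exact: cvg_snd.
have K0 : axes @` inscribed_frames F !=set0.
  exists 0, (1%:M, 0, p); last by rewrite /axes /= trmx0.
  split=> /= [|i|x _]; first by rewrite /orthogonal_mx trmx1 mulmx1.
    by rewrite mxE.
  by rewrite linear0 mulmx0 !mul0mx add0r.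
have Kc : compact (axes @` inscribed_frames F).
  apply: continuous_compact; first exact: continuous_subspaceT.
  exact: inscribed_frames_compact.
have [|_ /set_mem[[[U a] t] [/= UU a0 UF] <-] max] :=
    @compact_EVT_max _ R f _ K0 Kc.
  apply: continuous_subspaceW fcont => _ [z [_ a0 _] <-] i.
  by rewrite mxE.
have sizeE V (b : 'rV[R]_d) s : orthogonal_mx V -> (forall i, 0 <= b ord0 i) ->
    ellipsoid_size f (ellipsoid (V *m diag_mx b *m V^T) s) = f b^T.
  move=> VV b0; apply: ellipsoid_size_eigenvalues => //.
    exact: sym_psd_diag_conj.
  exact: diag_conj_eigenvalue_vector.
exists (ellipsoid (U *m diag_mx a *m U^T) t); split.
- by exists (U *m diag_mx a *m U^T), t.
- exact: ellipsoid_sub.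
- move=> _ /ellipsoid_sym_psd[P [s [Ppsd ->]]] PF.
  have [V [b [VV b0 PE]]] := sym_psd_eigendecomposition Ppsd.
  rewrite PE !sizeE//; apply: max; apply/mem_set; exists (V, b, s) => //.
  split=> //= x x1; apply: PF; rewrite -PE; exact: mem_ellipsoid.
Qed.

End Existence.

(** * Uniqueness of the maximal ellipsoid *)

Section Uniqueness.
Context {R : realType} {d : nat}.
Implicit Types (P Q U : 'M[R]_d) (t s v x : 'cV[R]_d) (F : set 'cV[R]_d).

Lemma midpoint_ellipsoid P Q t s F : convex_set F ->
  ellipsoid P t `<=` F -> ellipsoid Q s `<=` F ->
  ellipsoid (2^-1 *: P + (1 - 2^-1) *: Q) (2^-1 *: t + (1 - 2^-1) *: s)
    `<=` F.
Proof.
move=> cF PF QF; apply: ellipsoid_sub => x x1.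
have -> : (2^-1 *: P + (1 - 2^-1) *: Q) *m x +
    (2^-1 *: t + (1 - 2^-1) *: s) =
    2^-1 *: (P *m x + t) + (1 - 2^-1) *: (Q *m x + s).
  by rewrite mulmxDl -!scalemxAl !scalerDr addrACA.
apply: convex_set_comb => //; last by lra.
- exact/PF/mem_ellipsoid.
- exact/QF/mem_ellipsoid.
Qed.

(** For [x] in the unit ball, [r = (v . x) / |v|] lies in [[-1, 1]], so
    [P x + r v + t] is on the segment between the images of [x] in the two
    translates by [- v] and [v]. *)
Lemma elongated_ellipsoid P t v F : convex_set F ->
  ellipsoid P (t - v) `<=` F -> ellipsoid P (t + v) `<=` F ->
  ellipsoid (P + (euclidean_norm v)^-1 *: (v *m v^T)) t `<=` F.
Proof.
move=> cF PF QF; apply: ellipsoid_sub => x x1; set n := euclidean_norm v.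
have n0 : 0 <= n by rewrite /n euclidean_normE sqrtr_ge0.
have vx : v *m v^T *m x = dot v x *: v.
  apply/colP => i; rewrite -mulmxA mxE big_ord1 [RHS]mxE mulrC.
  by congr (_ * _).
pose r := n^-1 * dot v x.
have r1 : -1 <= r <= 1.
  have [nz|nz] := eqVneq n 0.
    by rewrite /r nz invr0 mul0r; lra.
  have np : 0 < n by rewrite lt_neqAle eq_sym nz.
  have le1 y : dot y y <= 1 -> n^-1 * dot v y <= 1.
    by move=> y1; rewrite mulrC ler_pdivrMr// mul1r dotC dot_le_norm.
  have := le1 (- x); rewrite dotNl !dotNr opprK mulrN => /(_ x1).
  by have := le1 x x1; rewrite /r; lra.
have -> : (P + n^-1 *: (v *m v^T)) *m x + t =
    ((1 - r) / 2) *: (P *m x + (t - v)) +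
    (1 - (1 - r) / 2) *: (P *m x + (t + v)).
  rewrite mulmxDl -scalemxAl vx scalerA -/r.
  by apply/colP => i; rewrite !mxE; lra.
apply: convex_set_comb => //; last by lra.
- exact/PF/mem_ellipsoid.
- exact/QF/mem_ellipsoid.
Qed.

Context (f : 'cV[R]_d -> R).
Hypothesis fsize : size_function f.
Hypothesis fconc : strictly_concave_on nonneg_orthant f.

Let fcont : {within nonneg_orthant, continuous f}. Proof. by case: fsize. Qed.
Let finc : strictly_increasing_in_each_argument f. Proof. by case: fsize. Qed.
Let fsym : symmetric_function f. Proof. by case: fsize. Qed.

Lemma ellipsoid_size_leif P t U : sym_psd P -> orthogonal_mx U ->
  ellipsoid_size f (ellipsoid P t) <= f (diag_col (U^T *m P *m U))
    ?= iff is_diag_mx (U^T *m P *m U).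
Proof.
move=> Ppsd UU; have [a Pa] := exists_eigenvalue_vector Ppsd.
rewrite (ellipsoid_size_eigenvalues t fsym Ppsd Pa).
exact: eigenvalues_minimize.
Qed.

Lemma ellipsoid_size_diag P t U : sym_psd P -> orthogonal_mx U ->
  is_diag_mx (U^T *m P *m U) ->
  ellipsoid_size f (ellipsoid P t) = f (diag_col (U^T *m P *m U)).
Proof.
by move=> Ppsd UU Pdiag; apply/eqP; rewrite (ellipsoid_size_leif t Ppsd UU).
Qed.

Lemma sym_psd_comb P Q (l : R) : sym_psd P -> sym_psd Q -> 0 <= l <= 1 ->
  sym_psd (l *: P + (1 - l) *: Q).
Proof.
move=> /sym_psdP[PT P0] /sym_psdP[QT Q0] /andP[l0 l1]; apply/sym_psdP; split.
  by rewrite linearD /= !linearZ /= PT QT.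
move=> u; rewrite mulmxDl -!scalemxAl dotDr !dotZr.
by rewrite addr_ge0// mulr_ge0// subr_ge0.
Qed.

(** In an eigenframe of the larger matrix, its diagonal dominates that of [P]
    and exceeds it wherever [v] has a nonzero component, while [f] of the
    diagonal of [P] is already at least the size of [P]. *)
Lemma ellipsoid_size_rank1 P v t (c : R) : sym_psd P -> 0 < c -> v != 0 ->
  ellipsoid_size f (ellipsoid P t) <
  ellipsoid_size f (ellipsoid (P + c *: (v *m v^T)) t).
Proof.
move=> Ppsd c0 v0; set P' := P + _.
have vvq (u : 'cV[R]_d) : dot u (v *m v^T *m u) = dot v u ^+ 2.
  rewrite -mulmxA; have -> : v^T *m u = (dot v u)%:M.
    by apply/matrixP => i j; rewrite !ord1 [RHS]mxE eqxx mulr1n.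
  by rewrite mul_mx_scalar dotZr (dotC u) expr2.
have P'psd : sym_psd P'.
  move/sym_psdP: Ppsd => [PT P0]; apply/sym_psdP; split.
    by rewrite linearD /= linearZ /= trmx_mul trmxK PT.
  move=> u; rewrite mulmxDl -scalemxAl dotDr dotZr vvq.
  by rewrite addr_ge0// mulr_ge0 ?sqr_ge0// ltW.
have [U UU Udiag] := spectral_theorem P'psd.
rewrite (ellipsoid_size_diag t P'psd UU Udiag).
apply: (le_lt_trans (ellipsoid_size_leif t Ppsd UU)).
have entryE i : diag_col (U^T *m P' *m U) i ord0 =
    diag_col (U^T *m P *m U) i ord0 + c * dot v (col i U) ^+ 2.
  rewrite [LHS]mxE [X in X + _]mxE !dot_conj_entry.
  by rewrite mulmxDl -scalemxAl dotDr dotZr vvq.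
have [i vi] : exists i, dot v (col i U) != 0.
  apply/existsP; apply: contraNT v0 => /existsPn v0.
  have Uv : U^T *m v = 0.
    apply/colP => i; rewrite [RHS]mxE -dot_e dot_trr trmxK -colE dotC.
    by apply/eqP; have := v0 i; rewrite negbK.
  by rewrite -[v]mul1mx -(orthogonal_mxC UU) -mulmxA Uv mulmx0.
apply: (@increasing_lt _ _ f _ _ i) => //.
- exact/sym_psd_diag_ge0/sym_psd_conj.
- by move=> j; rewrite entryE lerDl mulr_ge0 ?sqr_ge0// ltW.
- by rewrite entryE ltrDl mulr_gt0// exprn_even_gt0.
Qed.

(** In an eigenframe [U] of the midpoint [M], the diagonals [p] and [q] of the
    two shapes satisfy [m <= f p] and [m <= f q], while [f] of their average is
    the size of an ellipsoid in [F], hence at most [m]. *)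
Lemma maximal_shape_unique P Q t s F : convex_set F ->
  sym_psd P -> sym_psd Q ->
  maximal_ellipsoid_in f F (ellipsoid P t) ->
  maximal_ellipsoid_in f F (ellipsoid Q s) -> P = Q.
Proof.
move=> cF Ppsd Qpsd [PE PF Pmax] [QE QF Qmax].
set m := ellipsoid_size f (ellipsoid P t) in Pmax.
have mE : ellipsoid_size f (ellipsoid Q s) = m.
  by apply/eqP; rewrite eq_le Pmax// Qmax.
pose M := 2^-1 *: P + (1 - 2^-1) *: Q.
have Mpsd : sym_psd M by apply: sym_psd_comb => //; lra.
have [U UU Mdiag] := spectral_theorem Mpsd.
set p := diag_col (U^T *m P *m U); set q := diag_col (U^T *m Q *m U).
have Mm : f (2^-1 *: p + (1 - 2^-1) *: q) <= m.
  have -> : 2^-1 *: p + (1 - 2^-1) *: q = diag_col (U^T *m M *m U).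
    rewrite /M mulmxDr mulmxDl -!scalemxAr -!scalemxAl.
    by apply/colP => i; rewrite [RHS]mxE [RHS]mxE !mxE.
  rewrite -(ellipsoid_size_diag (2^-1 *: t + (1 - 2^-1) *: s) Mpsd UU Mdiag).
  by apply: Pmax; [eexists; eexists; reflexivity|exact: midpoint_ellipsoid].
have [mp mpE] := ellipsoid_size_leif t Ppsd UU; rewrite -/m -/p in mp mpE.
have [mq mqE] := ellipsoid_size_leif s Qpsd UU; rewrite mE -/q in mq mqE.
have pq : p = q.
  apply/eqP; apply: contraT => pq; rewrite leNgt in Mm; case/negP: Mm.
  have half : 0 < (2^-1 : R) < 1 by lra.
  apply: le_lt_trans (fconc (sym_psd_diag_ge0 (sym_psd_conj U Ppsd))
    (sym_psd_diag_ge0 (sym_psd_conj U Qpsd)) pq half).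
  by rewrite -/p -/q; lra.
have {}Mm : f p <= m by move: Mm; rewrite -pq -scalerDl addrC subrK scale1r.
have Pdiag : is_diag_mx (U^T *m P *m U).
  by rewrite -mpE eq_le Mm mp.
have Qdiag : is_diag_mx (U^T *m Q *m U).
  by rewrite -mqE -pq eq_le Mm mp.
have PQ : U^T *m P *m U = U^T *m Q *m U.
  apply/matrixP => i j; have [<-|ij] := eqVneq i j.
    by move/colP: pq => /(_ i); rewrite [LHS]mxE [RHS]mxE.
  by rewrite (is_diag_mxP Pdiag)// (is_diag_mxP Qdiag).
have := congr1 (fun X => U *m X *m U^T) PQ.
rewrite /= !mulmxA orthogonal_mxC// !mul1mx -!mulmxA.
by rewrite orthogonal_mxC// !mulmx1.
Qed.

(** The two centres are [c - v] and [c + v], so [F] also contains the elongation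
    along [v] of the same shape centred at [c]. *)
Lemma maximal_center_unique P t s F : convex_set F -> sym_psd P ->
  maximal_ellipsoid_in f F (ellipsoid P t) ->
  maximal_ellipsoid_in f F (ellipsoid P s) -> t = s.
Proof.
move=> cF Ppsd [_ PF Pmax] [_ QF Qmax]; apply/eqP; apply: contraT => ts.
pose c := 2^-1 *: (t + s); pose v := 2^-1 *: (s - t).
have tE : t = c - v by apply/colP => i; rewrite !mxE; lra.
have sE : s = c + v by apply/colP => i; rewrite !mxE; lra.
have v0 : v != 0.
  by rewrite scaler_eq0 invr_eq0 pnatr_eq0 subr_eq0 /= eq_sym.
have n0 : 0 < (euclidean_norm v)^-1.
  rewrite invr_gt0 euclidean_normE sqrtr_gt0 lt_neqAle dot_ge0 andbT eq_sym.
  by apply: contra_neq v0 => /dot_eq0.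
have sizeE :
    ellipsoid_size f (ellipsoid P c) = ellipsoid_size f (ellipsoid P t).
  have [a Pa] := exists_eigenvalue_vector Ppsd.
  by rewrite !(ellipsoid_size_eigenvalues _ fsym Ppsd Pa).
have := ellipsoid_size_rank1 c Ppsd n0 v0.
rewrite sizeE ltNge Pmax//; first by eexists; eexists; reflexivity.
by apply: elongated_ellipsoid => //; rewrite -?tE -?sE.
Qed.

End Uniqueness.

Unset Implicit Arguments.

Theorem theorem5 (R : realType) (d : nat) (f : 'cV[R]_d -> R)
  (F : set 'cV[R]_d) :
  size_function f ->
  strictly_concave_on nonneg_orthant (f \o w 1) ->
  convex_body F ->
  exists! E : set 'cV[R]_d, maximal_ellipsoid_in f F E.
Proof.
move=> fsize /strictly_concave_w1 fconc [Fcpt cF [p /interior_subset Fp]].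
have [_ fcont _ fsym] := fsize.
have F0 : F !=set0 by exists p.
have [E Emax] := exists_maximal_ellipsoid fcont fsym Fcpt F0.
exists E; split=> // E' E'max.
case: (Emax) (E'max) => /ellipsoid_sym_psd[P [t [Ppsd EE]]] _ _.
move=> [/ellipsoid_sym_psd[Q [s [Qpsd E'E]]] _ _].
subst E E'.
have PQ := maximal_shape_unique fsize fconc cF Ppsd Qpsd Emax E'max.
subst Q.
by rewrite (maximal_center_unique fsize fconc cF Ppsd Emax E'max).
Qed.
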